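(* Suppose $\mathcal P_k^F$ is nonempty. If $\underline z<\overline z$, then $\underline z$ is a lower bound and $\overline z$ is an upper bound on the minimum of $c^{T}x$ over the $S_k$-closure. Otherwise, $\overline z\le\underline z$ and $\overline z$ is the minimum of $c^{T}x$ over the $S_k$-closure.
   Context: $P=\{x\in\mathbb R^n: Ax\ge b,\ x\ge 0\}$ (rational data) is a full-dimensional pointed polyhedron, $I\subseteq\{1,\dots,n\}$, $P_I=\{x\in P: x_j\in\mathbb Z \text{ for all } j\in I\}$. For $c\in\mathbb Q^n$, $\bar x$ is an optimal basic feasible solution of $\min\{c^{T}x: x\in P\}$. $\bar C$ is the (simplicial) polyhedral cone with apex $\bar x$ defined by the $n$ hyperplanes corresponding to the nonbasic variables at $\bar x$. $C$ is a relaxation of $P$ (so $P\subseteq C$) obtained by adding to the description of $\bar C$ a subset of the other inequalities defining $P$. Let $k\in I$ with $\bar x_k\notin\mathbb Z$ and $S_k=\{x:\lfloor\bar x_k\rfloor\le x_k\le\lceil\bar x_k\rceil\}$. The $S_k$-closure is $\operatorname{conv}(P\setminus\operatorname{int}S_k)$. $(\mathcal P_k,\mathcal R_k)$ is the point-ray collection obtained from intersecting the edges of $C$ with $\operatorname{bd}S_k$: $\mathcal P_k$ is the set of intersection points of edges of $C$ with $\operatorname{bd}S_k$, and $\mathcal R_k$ the set of (directions of) unbounded edges of $C$ that do not intersect $\operatorname{bd}S_k$. An intersection point in $\mathcal P_k$ is final if it belongs to $P$ (and $\operatorname{bd}S_k$); $\mathcal P_k^F\subseteq\mathcal P_k$ is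 the set of final intersection points. Let $\overline p^k\in\arg\min_{p\in\mathcal P_k^F}c^{T}p$, $\underline p^k\in\arg\min_{p\in\mathcal P_k}c^{T}p$, $\overline z=c^{T}\overline p^k$ and $\underline z=c^{T}\underline p^k$.
   Formalization: The basis defining the nonbasic variables at the optimal basic feasible solution is assumed to have nonnegative reduced costs; this is automatic at a nondegenerate vertex, and at a degenerate vertex the claim can fail for another basis. *)

(* Defs.v *)
From HB Require Import structures.
From mathcomp Require Import all_boot all_order all_algebra.
From mathcomp Require Import all_classical all_reals all_analysis.
Import Order.TTheory GRing.Theory Num.Theory.
Import numFieldNormedType.Exports.

Set Implicit Arguments.
Unset Strict Implicit.
Unset Printing Implicit Defensive.

Local Open Scope classical_set_scope.
Local Open Scope ring_scope.

Definition ratmx {R : realType} {m n} (M : 'M[rat]_(m, n)) : 'M[R]_(m, n) :=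
  map_mx ratr M.

Section Geometry.
Variables (R : realType) (n : nat).
Implicit Types (S F : set 'cV[R]_n).

Definition dotv (c x : 'cV[R]_n) : R := (c^T *m x) 0 0.

(* The affine hull of S has dimension d: it is x0 plus the column space of a
   rank-d matrix V whose columns are differences of points of S. *)
Definition affine_dim S (d : nat) : Prop :=
  exists (x0 : 'cV[R]_n) (V : 'M[R]_(n, d)),
    [/\ \rank V = d, S x0, forall j, S (x0 + col j V) &
        forall y, S y -> exists t : 'cV[R]_d, y = x0 + V *m t].

Definition full_dimensional S : Prop := affine_dim S n.

Definition pointed_set S : Prop :=
  (exists x, S x) /\
  forall x d : 'cV[R]_n, (forall t : R, S (x + t *: d)) -> d = 0.

Definition face S F : Prop :=
  exists (a : 'cV[R]_n) (beta : R),
    (forall x, S x -> beta <= dotv a x) /\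
    F = S `&` [set x | dotv a x = beta].

Definition edge S F : Prop := face S F /\ affine_dim F 1.

Definition boundary S : set 'cV[R]_n := closure S `\` S°.

Definition conv S : set 'cV[R]_n := smallest (@convex_set R _) S.

Definition argmin (f : 'cV[R]_n -> R) S : set 'cV[R]_n :=
  [set x | S x /\ forall y, S y -> f x <= f y].

Definition is_minimum (f : 'cV[R]_n -> R) S (v : R) : Prop :=
  exists2 x, argmin f S x & f x = v.

End Geometry.

Section LinearProgram.
Variables (R : realType) (m n : nat).
Variables (A : 'M[R]_(m, n)) (b : 'cV[R]_m) (c : 'cV[R]_n).

Definition polyhedron : set 'cV[R]_n :=
  [set x | (forall i, b i 0 <= (A *m x) i 0) /\ (forall j, 0 <= x j 0)].

(* Standard form: the n + m variables are x followed by the surplus variables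
   s = A x - b; the constraints are A x - s = b and (x, s) >= 0. *)
Definition std_mx : 'M[R]_(m, n + m) := row_mx A (- 1%:M).

Definition std_cost : 'rV[R]_(n + m) := row_mx c^T 0.

Definition std_var (x : 'cV[R]_n) : 'cV[R]_(n + m) := col_mx x (A *m x - b).

(* A basis lists m variables whose columns in the standard form are
   nonsingular (hence are pairwise distinct), leaving n nonbasic variables. *)
Definition is_basis (B : 'I_m -> 'I_(n + m)) : Prop :=
  colsub B std_mx \in unitmx.

Definition nonbasic (B : 'I_m -> 'I_(n + m)) : {set 'I_(n + m)} :=
  [set j | j \notin codom B]%SET.

Definition reduced_cost (B : 'I_m -> 'I_(n + m)) : 'rV[R]_(n + m) :=
  std_cost - colsub B std_cost *m invmx (colsub B std_mx) *m std_mx.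

(* The reduced-cost condition is the simplex optimality certificate. At a
   nondegenerate vertex it follows from the optimality of xbar; at a degenerate
   one it says that the basis describing xbar is itself an optimal basis. *)
Definition optimal_bfs (B : 'I_m -> 'I_(n + m)) (xbar : 'cV[R]_n) : Prop :=
  [/\ is_basis B,
      forall j, j \in nonbasic B -> std_var xbar j 0 = 0,
      argmin (dotv c) polyhedron xbar &
      forall j, j \in nonbasic B -> 0 <= reduced_cost B 0 j].

Definition basis_cone (B : 'I_m -> 'I_(n + m)) : set 'cV[R]_n :=
  [set x | forall j, j \in nonbasic B -> 0 <= std_var x j 0].

(* The inequality with index j is the nonnegativity of the j-th variable of the
   standard form, i.e. one of x_j >= 0 and (A x)_i >= b_i. *)
Definition relaxation (B : 'I_m -> 'I_(n + m)) (T : {set 'I_(n + m)}) :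
    set 'cV[R]_n :=
  basis_cone B `&` [set x | forall j, j \in T -> 0 <= std_var x j 0].

End LinearProgram.

Section Split.
Variables (R : realType) (n : nat).
Implicit Types (P C S : set 'cV[R]_n).

Definition split_set (xbar : 'cV[R]_n) (k : 'I_n) : set 'cV[R]_n :=
  [set x | (Num.floor (xbar k 0))%:~R <= x k 0 <= (Num.ceil (xbar k 0))%:~R].

Definition S_closure P S : set 'cV[R]_n := conv (P `\` S°).

Definition intersection_points C S : set 'cV[R]_n :=
  [set p | exists2 F, edge C F & (F `&` boundary S) p].

Definition final_points P C S : set 'cV[R]_n := intersection_points C S `&` P.

End Split.

(* Main.v *)
Require Import Defs.
From mathcomp Require Import all_boot all_order all_algebra.
From mathcomp Require Import all_classical all_reals all_analysis.
From mathcomp Require Import ring lra.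
Import Order.TTheory GRing.Theory Num.Theory.
Import numFieldNormedType.Exports.
Set Implicit Arguments.
Unset Strict Implicit.
Unset Printing Implicit Defensive.
Local Open Scope classical_set_scope.
Local Open Scope ring_scope.

(** Write lo < xbar_k < hi for the two integers around xbar_k. The complement
of the interior of S is the pair of closed half-spaces x_k <= lo and x_k >= hi,
so the S-closure is the convex hull of two polyhedra cut out of P. A linear
function has the same minimum on a set and on its convex hull ([argmin_conv]),
hence everything reduces to the points x of P outside the interior of S.

The minimum is attained because each of the two pieces is a polyhedron without
lines on which the cost is bounded below: such a polyhedron has, below any of
its points, a vertex ([vertex_below]), and a vertex is determined by the set of
its tight constraints, so there are finitely many ([argmin_exists]).
The point pup is one of the competitors, which gives the upper bound.

For the lower bound, take x in P outside the interior of S. The reduced costs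
are nonnegative on the basis cone, so xbar is cheapest in C as well
([basis_cone_cost_ge]). The segment from xbar to x stays in C and meets a
hyperplane x_k = r with r = lo or r = hi, at a point no more expensive than x.
Below that point the slice of C by x_k = r has a vertex p ([slice_vertex]), and
p lies on an edge of C ([edge_crossing]): either the tight constraints of C at
p leave one direction free, and it spans an edge crossing the hyperplane at p,
or p is already a vertex of C, which starts an edge since C contains another
point ([edge_at_vertex]). So p is an intersection point and costs at least what
plow does.

If plow is no cheaper than pup, the two bounds meet at pup.

Ranks never appear: that the tight constraints have rank n is expressed by
saying that only the zero direction is orthogonal to all of them
([spanning]). *)

(** * Linear functionals *)

Section Dot.
Variables (R : realType) (n : nat).
Implicit Types (a x d : 'cV[R]_n).

Lemma dotvD a x d : dotv a (x + d) = dotv a x + dotv a d.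
Proof. by rewrite /dotv mulmxDr mxE. Qed.

Lemma dotvZ a t x : dotv a (t *: x) = t * dotv a x.
Proof. by rewrite /dotv -scalemxAr mxE. Qed.

Lemma dotvN a x : dotv a (- x) = - dotv a x.
Proof. by rewrite -scaleN1r dotvZ mulN1r. Qed.

Lemma dotvB a x d : dotv a (x - d) = dotv a x - dotv a d.
Proof. by rewrite dotvD dotvN. Qed.

Lemma dotv0l x : dotv 0 x = 0.
Proof. by rewrite /dotv trmx0 mul0mx mxE. Qed.

Lemma dotvNl a x : dotv (- a) x = - dotv a x.
Proof. by rewrite /dotv linearN /= mulNmx mxE. Qed.

Lemma dotv_suml (J : finType) (E : {set J}) (g : J -> 'cV[R]_n) x :
  dotv (\sum_(i in E) g i) x = \sum_(i in E) dotv (g i) x.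
Proof. by rewrite /dotv linear_sum /= mulmx_suml summxE. Qed.

Lemma dotv_delta j x : dotv (delta_mx j 0) x = x j 0.
Proof. by rewrite /dotv trmx_delta -rowE mxE. Qed.

Lemma dotv_row p (M : 'M[R]_(p, n)) i x : dotv (row i M)^T x = (M *m x) i 0.
Proof. by rewrite /dotv trmxK -row_mul mxE. Qed.

End Dot.

(** * Vertices and edges of polyhedra given by inequalities *)

Section Polyhedra.
Variables (R : realType) (n : nat).
Implicit Types (x v d z c l : 'cV[R]_n).

Definition halfspaces (I : finType) (g : I -> 'cV[R]_n) (h : I -> R) :
    set 'cV[R]_n := [set x | forall i, h i <= dotv (g i) x].

Definition tight (I : finType) (g : I -> 'cV[R]_n) (h : I -> R) x : {set I} :=
  [set i | dotv (g i) x == h i]%SET.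

(** For the tight set of a point of the polyhedron, this says that the point is a
vertex; for the set of all constraints, that the polyhedron contains no
line. *)
Definition spanning (I : finType) (g : I -> 'cV[R]_n) (A : {set I}) : Prop :=
  forall d, (forall i, i \in A -> dotv (g i) d = 0) -> d = 0.

Section OneSystem.
Variables (I : finType) (g : I -> 'cV[R]_n) (h : I -> R).
Local Notation Q := (halfspaces g h).
Local Notation tightQ := (tight g h).

(** The ratio test of the simplex method: the first constraint hit along d is the
one minimizing slack over rate of decrease. *)
Lemma ratio_test v d i0 : Q v -> dotv (g i0) d < 0 ->
  exists t i, [/\ 0 <= t, Q (v + t *: d), dotv (g i) d < 0 &
                  dotv (g i) (v + t *: d) = h i].
Proof.
move=> Qv neg0; pose r i := (dotv (g i) v - h i) / - dotv (g i) d.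
case: (@arg_minP _ _ _ i0 (fun i => dotv (g i) d < 0) r neg0) => i neg mini.
have r0 : 0 <= r i.
  by apply: divr_ge0; [rewrite subr_ge0; exact: Qv|rewrite oppr_ge0 ltW].
exists (r i), i; split=> //.
- move=> j; rewrite dotvD dotvZ; case: (ltP (dotv (g j) d) 0) => [negj|posj].
    have := mini j negj; rewrite [r j]/r ler_pdivlMr ?oppr_gt0//; lra.
  have : 0 <= r i * dotv (g j) d by exact: mulr_ge0.
  by have := Qv j; lra.
- by rewrite dotvD dotvZ /r; field; rewrite lt_eqF.
Qed.

(** The step of the ratio test is positive here, since the constraint that stops
the move was not tight at v. *)
Lemma feasible_step v d : Q v ->
    (forall i, i \in tightQ v -> 0 <= dotv (g i) d) ->
  exists2 t, 0 < t & Q (v + t *: d).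
Proof.
move=> Qv feas.
have [/existsP[i0 neg0]|/existsPn pos] := boolP [exists i, dotv (g i) d < 0].
  have [t [i [t0 Qt neg eqi]]] := ratio_test Qv neg0.
  exists t => //; rewrite lt_def t0 andbT; apply: contraTneq neg => t00.
  rewrite -leNgt feas// inE; apply/eqP.
  by rewrite -eqi t00 scale0r addr0.
exists 1 => // i; rewrite scale1r dotvD.
by have := Qv i; have := pos i; rewrite -leNgt; lra.
Qed.

(** Move along a direction that keeps the tight constraints tight and does not
increase the cost until a new constraint becomes tight; this is an induction on
the number of constraints that are not tight. *)
Lemma vertex_below c beta x : spanning g [set: I]%SET ->
    (forall y, Q y -> beta <= dotv c y) -> Q x ->
  exists v, [/\ Q v, dotv c v <= dotv c x & spanning g (tightQ v)].
Proof.
move=> ptd bnd; have [k] := ubnP #|~: tightQ x|.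
elim: k x => // k IH x; rewrite ltnS => lek Qx.
have [?|/existsNP[d /not_implyP[killd /eqP d0]]] := pselect (spanning g (tightQ x)).
  by exists x.
have [e [kille cle [i0 neg0]]] : exists e, [/\
    forall i, i \in tightQ x -> dotv (g i) e = 0, dotv c e <= 0 &
    exists i, dotv (g i) e < 0].
  wlog cd : d killd d0 / dotv c d <= 0.
    move=> W; have [|cd] := leP (dotv c d) 0; first exact: W.
    apply: (W (- d)); rewrite ?oppr_eq0// ?dotvN; last by lra.
    by move=> i /killd; rewrite dotvN => ->; rewrite oppr0.
  (* If d leaves the polyhedron nowhere, the lower bound forces its cost to be
     zero, and the opposite direction does leave it, as there are no lines. *)
  have [/existsP[i neg]|/existsPn pos] := boolP [exists i, dotv (g i) d < 0].
    by exists d; split => //; exists i.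
  have cd0 : dotv c d = 0.
    apply/eqP; rewrite eq_le cd leNgt /=; apply/negP => cd0.
    pose t := (dotv c x - beta + 1) / - dotv c d.
    have t0 : 0 <= t by rewrite divr_ge0 ?oppr_ge0//; have := bnd _ Qx; lra.
    have : Q (x + t *: d).
      move=> i; rewrite dotvD dotvZ.
      have : 0 <= t * dotv (g i) d by rewrite mulr_ge0// leNgt pos.
      by have := Qx i; lra.
    move=> /bnd; rewrite dotvD dotvZ.
    have -> : t * dotv c d = - (dotv c x - beta + 1).
      by rewrite /t; field; rewrite lt_eqF.
    by lra.
  have [i nzi] : exists i, dotv (g i) d != 0.
    apply/not_existsP => Z; move/eqP: d0; apply; apply: ptd => i _.
    by apply/eqP/negPn/negP; exact: Z.
  exists (- d); split; first by move=> j /killd; rewrite dotvN => ->; rewrite oppr0.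
    by rewrite dotvN cd0 oppr0.
  exists i; rewrite dotvN oppr_lt0 lt_def nzi leNgt; exact: pos.
have [t [i [t0 Qy negi eqi]]] := ratio_test Qx neg0.
have [|v [Qv cv spv]] := IH (x + t *: e) _ Qy.
  apply: leq_trans lek; apply: proper_card; apply/properP; split.
    apply/fintype.subsetP => j; rewrite !inE dotvD dotvZ; apply: contraNN => jx.
    by rewrite kille ?inE// mulr0 addr0.
  exists i; rewrite !inE ?eqi ?eqxx//; apply/eqP => ti.
  by move: negi; rewrite kille ?ltxx// inE ti.
exists v; split => //; apply: le_trans cv _.
rewrite dotvD dotvZ; have : 0 <= t * - dotv c e by rewrite mulr_ge0// oppr_ge0.
by lra.
Qed.

(** Two vertices with the same tight set coincide, so one vertex for each set of
constraints suffices: the cheapest of these finitely many is a minimum. *)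
Lemma argmin_exists c beta : spanning g [set: I]%SET ->
    (forall y, Q y -> beta <= dotv c y) -> Q !=set0 ->
  argmin (dotv c) Q !=set0.
Proof.
move=> ptd bnd [x0 Qx0].
have [v0 [Qv0 _ _]] := vertex_below ptd bnd Qx0.
(* w E is the vertex with tight set E if there is one, and a default point
   otherwise. *)
have /choice[w wP] (E : {set I}) : exists w, Q w /\
    ((exists v, [/\ Q v, tightQ v = E & spanning g E]) ->
      tightQ w = E /\ spanning g E).
  have [[v [Qv tv sp]]|nov] :=
    pselect (exists v, [/\ Q v, tightQ v = E & spanning g E]).
    by exists v.
  by exists v0.
case: (@arg_minP _ _ _ finset.set0 xpredT (fun E => dotv c (w E)) erefl)
  => E _ minE.
exists (w E); split; first by case: (wP E).
move=> y Qy; have [v [Qv cv spv]] := vertex_below ptd bnd Qy.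
have [_ []] := wP (tightQ v); first by exists v.
move=> tw _; apply: le_trans cv; suff <- : w (tightQ v) = v by exact: minE.
apply/eqP; rewrite -subr_eq0; apply/eqP/spv => i iv; rewrite dotvB.
have: i \in tightQ (w (tightQ v)) by rewrite tw.
by move: iv; rewrite !inE => /eqP -> /eqP ->; rewrite subrr.
Qed.

(** The constraints that are tight at v and constant along d cut out a face; the
hypothesis on l makes the direction of that face exactly the line spanned
by d. *)
Lemma edge_through v d l : Q v ->
    (forall i, i \in tightQ v -> 0 <= dotv (g i) d) -> dotv l d != 0 ->
    (forall z, (forall i, i \in tightQ v -> dotv (g i) d = 0 -> dotv (g i) z = 0) ->
       dotv l z = 0 -> z = 0) ->
  exists2 F, edge Q F & F v.
Proof.
move=> Qv feas ld only.
have [e e0 Qe] := feasible_step Qv feas.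
pose E : {set I} := [set i in tightQ v | dotv (g i) d == 0]%SET.
have EP i : i \in E -> dotv (g i) v = h i /\ dotv (g i) d = 0.
  by rewrite !inE => /andP[/eqP -> /eqP ->].
pose F := Q `&` [set x | dotv (\sum_(i in E) g i) x = \sum_(i in E) h i].
have inF x : Q x -> (forall i, i \in E -> dotv (g i) x = h i) -> F x.
  by move=> Qx tx; split => //=; rewrite dotv_suml; apply: eq_bigr.
have Ftight x i : F x -> i \in E -> dotv (g i) x = h i.
  move=> [Qx /=]; rewrite dotv_suml => /eqP.
  rewrite -subr_eq0 -sumrB => /eqP s0 iE; apply/eqP; rewrite -subr_eq0; apply/eqP.
  by apply: (psumr_eq0P _ s0) => // j _; rewrite subr_ge0.
have Fv : F v by apply: inF => // i /EP[].
(* The sum of the constraints in E is a supporting functional of the face. *)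
exists F => //; split.
  exists (\sum_(i in E) g i), (\sum_(i in E) h i); split=> // x Qx.
  by rewrite dotv_suml ler_sum.
exists v, (e *: d); split => //.
- rewrite -mxrank_tr rank_rV; apply/eqP; rewrite eqb1 trmx_eq0 scaler_eq0.
  rewrite gt_eqF//=; apply: contra_neq ld => ->.
  by rewrite -(scale0r 0) dotvZ mul0r.
- move=> j; rewrite (_ : col j _ = e *: d); last first.
    by apply/matrixP => a b; rewrite !mxE !ord1.
  by apply: inF => // i /EP[gv gd]; rewrite dotvD dotvZ gd mulr0 addr0.
move=> y Fy; exists (dotv l (y - v) / (e * dotv l d))%:M.
apply/eqP; rewrite mul_mx_scalar -subr_eq0 opprD addrA; apply/eqP/only.
  move=> i iv gd; rewrite !(dotvB (g i)) !dotvZ gd !mulr0 subr0.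
  rewrite (Ftight y) ?inE ?gd ?eqxx ?andbT//; last by move: iv; rewrite inE.
  by move: iv; rewrite inE => /eqP ->; rewrite subrr.
rewrite [LHS]dotvB !dotvZ; field.
by rewrite ld gt_eqF.
Qed.

End OneSystem.

(** [vertex_below] for the polyhedron with the equation dotv l y = r added as two
opposite inequalities. *)
Lemma slice_vertex (I : finType) (g : I -> 'cV[R]_n) h c beta l r x :
    (forall d, (forall i, dotv (g i) d = 0) -> dotv l d = 0 -> d = 0) ->
    (forall y, halfspaces g h y -> dotv l y = r -> beta <= dotv c y) ->
    halfspaces g h x -> dotv l x = r ->
  exists v, [/\ halfspaces g h v, dotv l v = r, dotv c v <= dotv c x &
    forall d, (forall i, i \in tight g h v -> dotv (g i) d = 0) ->
      dotv l d = 0 -> d = 0].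
Proof.
move=> ptd bnd Qx lx.
pose g' (s : I + bool) := match s with inl i => g i | inr b => if b then l else - l end.
pose h' (s : I + bool) := match s with inl i => h i | inr b => if b then r else - r end.
have QE y : halfspaces g' h' y <-> halfspaces g h y /\ dotv l y = r.
  split=> [Qy|[Qy ly] [i|[]]] /=; [split|..].
  - by move=> i; exact: (Qy (inl i)).
  - apply/eqP; rewrite eq_le; have := Qy (inr true); have := Qy (inr false).
    by rewrite /= dotvNl lerN2 => -> ->.
  - exact: Qy.
  - by rewrite ly.
  - by rewrite dotvNl ly.
have [||/=|v [/QE[Qv lv] cv sp]] := @vertex_below _ g' h' c beta x.
- move=> d z; apply: ptd => [i|]; first by apply: (z (inl i)); rewrite inE.
  by apply: (z (inr true)); rewrite inE.
- by move=> y /QE[]; exact: bnd.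
- exact/QE.
exists v; split=> // d z ld; apply: sp => -[i|b].
  by rewrite inE /= => iv; apply: z; rewrite inE.
by case: b; rewrite /= ?dotvNl ld ?oppr0.
Qed.

(** The directions feasible at v form a cone on which the sum a of the tight
normals is positive except at 0. The slice of this cone where a is 1 contains a
multiple of w - v, hence has a vertex d; the ray along d is an extreme ray of
the cone, that is, the direction of an edge at v. *)
Lemma edge_at_vertex (I : finType) (g : I -> 'cV[R]_n) h v w :
    halfspaces g h v -> halfspaces g h w -> v != w ->
    spanning g (tight g h v) ->
  exists2 F, edge (halfspaces g h) F & F v.
Proof.
move=> Qv Qw vw sp; pose a := \sum_(i in tight g h v) g i.
pose gK (s : {i | i \in tight g h v}) := g (val s).
have gw i : i \in tight g h v -> 0 <= dotv (g i) (w - v).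
  by rewrite inE dotvB => /eqP ->; rewrite subr_ge0.
have awv : 0 < dotv a (w - v).
  rewrite lt_def dotv_suml sumr_ge0// andbT; apply: contra_neq vw => s0.
  apply/eqP; rewrite eq_sym -subr_eq0; apply/eqP/sp => i iv.
  exact: (psumr_eq0P _ s0).
have [||||d [/= Kd ad _ only]] := @slice_vertex _ gK (fun=> 0) 0 0 a 1
    ((dotv a (w - v))^-1 *: (w - v)).
- by move=> d z _; apply: sp => i iv; exact: (z (exist _ i iv)).
- by move=> y _ _; rewrite dotv0l.
- by move=> [i iv]; rewrite dotvZ mulr_ge0 ?invr_ge0 ?gw// ltW.
- by rewrite dotvZ mulVf// gt_eqF.
apply: (@edge_through _ g h v d a) => //.
- by move=> i iv; exact: (Kd (exist _ i iv)).
- by rewrite ad oner_neq0.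
move=> z zz; apply: only => -[i iv]; rewrite inE => /eqP /= gd.
exact: zz.
Qed.

(** The point p is a vertex of the slice where l is r. The point u is there to
exclude the degenerate case in which the polyhedron is a single point. *)
Lemma edge_crossing (I : finType) (g : I -> 'cV[R]_n) h c beta l r u x :
    spanning g [set: I]%SET ->
    (forall y, halfspaces g h y -> dotv l y = r -> beta <= dotv c y) ->
    halfspaces g h u -> dotv l u != r ->
    halfspaces g h x -> dotv l x = r ->
  exists F p, [/\ edge (halfspaces g h) F, F p, dotv l p = r &
                  dotv c p <= dotv c x].
Proof.
move=> ptd bnd Qu lu Qx lx.
have [|v [Qv lv cv sp]] := slice_vertex _ bnd Qx lx.
  by move=> d z _; apply: ptd => i _; exact: z.
suff [F eF Fv] : exists2 F, edge (halfspaces g h) F & F v by exists F, v.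
(* Otherwise some nonzero d is killed by the constraints tight at v; l does not
   kill it because v is a vertex of the slice. *)
have [spv|/existsNP[d /not_implyP[killd d0]]] :=
    pselect (spanning g (tight g h v)).
  by apply: (edge_at_vertex Qv Qu) => //; apply: contraNneq lu => <-; rewrite lv.
apply: (@edge_through _ g h v d l) => //.
- by move=> i /killd ->.
- by apply/eqP => ld; apply: d0; exact: sp.
by move=> z zz; apply: sp => i iv; apply: zz => //; exact: killd.
Qed.

End Polyhedra.

(** * The basis cone and its relaxations *)

Section BasisCone.
Variables (R : realType) (m n : nat).
Variables (A : 'M[R]_(m, n)) (b : 'cV[R]_m) (c : 'cV[R]_n).
Implicit Types (B : 'I_m -> 'I_(n + m)) (x d : 'cV[R]_n).

(** The normal and the bound of the inequality saying that the j-th variable of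
the standard form is nonnegative. *)
Definition std_normal (j : 'I_(n + m)) : 'cV[R]_n :=
  (row j (col_mx 1%:M A))^T.

Definition std_bound (j : 'I_(n + m)) : R := (col_mx 0 b : 'cV[R]_(n + m)) j 0.

Lemma dotv_std_normal j x : dotv (std_normal j) x = (col_mx x (A *m x)) j 0.
Proof. by rewrite dotv_row mul_col_mx mul1mx. Qed.

Lemma std_varE x j : std_var A b x j 0 = dotv (std_normal j) x - std_bound j.
Proof.
rewrite dotv_std_normal /std_var /std_bound !mxE.
by case: fintype.split => i; rewrite !mxE ?subr0.
Qed.

Lemma polyhedronE : polyhedron A b = halfspaces std_normal std_bound.
Proof.
apply/seteqP; split=> x.
  move=> [Ax x0] j; rewrite -subr_ge0 -std_varE /std_var mxE.
  by case: fintype.split => i; [exact: x0|rewrite !mxE subr_ge0; have := Ax i; rewrite mxE].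
move=> Q; rewrite /polyhedron/=; split=> [i|j].
  have := Q (rshift n i); rewrite -subr_ge0 -std_varE /std_var col_mxEd.
  by rewrite [X in 0 <= X]mxE [X in _ + X]mxE subr_ge0.
by have := Q (lshift m j); rewrite -subr_ge0 -std_varE /std_var col_mxEu.
Qed.

Definition subsystem (J : {set 'I_(n + m)}) : set 'cV[R]_n :=
  halfspaces (fun s : {j | j \in J} => std_normal (val s))
             (fun s => std_bound (val s)).

Lemma relaxationE B T : relaxation A b B T = subsystem (nonbasic B :|: T)%SET.
Proof.
apply/seteqP; split=> x.
  move=> [xB xT] [j /= /[dup] jU]; rewrite finset.in_setU -subr_ge0 -std_varE.
  by move=> /orP[]; [exact: xB|exact: xT].
move=> Q; split=> j jJ; rewrite std_varE subr_ge0;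
  by apply: (Q (exist _ j _)); rewrite finset.in_setU jJ ?orbT.
Qed.

Lemma polyhedron_sub_relaxation B T : polyhedron A b `<=` relaxation A b B T.
Proof. by rewrite polyhedronE relaxationE => x Px s; exact: Px. Qed.

(** Multiplying the standard form by the inverse of the basis matrix turns the
basic columns into the identity. *)
Lemma basis_coordE B (s : 'cV[R]_(n + m)) i : is_basis A B ->
    (forall j, j \in nonbasic B -> s j 0 = 0) ->
  (invmx (colsub B (std_mx A)) *m std_mx A *m s) i 0 = s (B i) 0.
Proof.
move=> Bu s0; set W := invmx _ *m _.
have WE l : W i (B l) = (i == l)%:R.
  have := congr1 (fun M : 'M[R]_m => M i l) (mulVmx Bu).
  by rewrite [RHS]mxE => <-; rewrite !mxE; apply: eq_bigr => j _; rewrite !mxE.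
rewrite mxE (bigD1 (B i))//= WE eqxx mul1r big1 ?addr0// => j jBi.
have [/codomP[l jl]|jB] := boolP (j \in codom B).
  by rewrite jl WE; case: eqP => [il|]; rewrite ?mul0r//; rewrite jl il eqxx in jBi.
by rewrite s0 ?mulr0// inE.
Qed.

(** The standard-form vector of d solves the homogeneous system, so it is
determined by its nonbasic coordinates: the apex is the only point where all
constraints of the basis cone are tight. *)
Lemma spanning_nonbasic B d : is_basis A B ->
  (forall j, j \in nonbasic B -> dotv (std_normal j) d = 0) -> d = 0.
Proof.
move=> Bu dB; pose s := col_mx d (A *m d).
have sB j : j \in nonbasic B -> s j 0 = 0 by rewrite -dotv_std_normal; exact: dB.
have s0 j : s j 0 = 0.
  have [/codomP[i ->]|jB] := boolP (j \in codom B); last by rewrite sB// inE.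
  rewrite -(basis_coordE _ Bu sB) -mulmxA mul_row_col mulNmx mul1mx subrr.
  by rewrite mulmx0 mxE.
by apply/colP => j; have := s0 (lshift m j); rewrite col_mxEu mxE.
Qed.

(** The cost is a constant plus the sum of reduced costs times variables; basic
variables have reduced cost zero, and nonbasic ones vanish at xbar. *)
Lemma basis_cone_cost_ge B xbar x : optimal_bfs A b c B xbar ->
  basis_cone A b B x -> dotv c xbar <= dotv c x.
Proof.
move=> [Bu nb0 _ rc0] xC.
pose K := (colsub B (std_cost m c) *m invmx (colsub B (std_mx A)) *m b) 0 0.
have rcE y : (reduced_cost A c B *m std_var A b y) 0 0 = dotv c y - K.
  have bE : std_mx A *m std_var A b y = b.
    by rewrite mul_row_col mulNmx mul1mx opprB addrCA subrr addr0.
  rewrite /reduced_cost mulmxBl -(mulmxA _ (std_mx A)) bE mul_row_col mul0mx addr0.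
  by rewrite mxE [X in _ + X]mxE.
have rcB i : reduced_cost A c B 0 (B i) = 0.
  rewrite /reduced_cost mxE [X in _ + X]mxE -mulmxA.
  have : (colsub B (std_cost m c) *m (invmx (colsub B (std_mx A)) *m
           colsub B (std_mx A))) 0 i = std_cost m c 0 (B i).
    by rewrite mulVmx// mulmx1 mxE.
  move=> <-; apply/eqP; rewrite subr_eq0 !mxE; apply/eqP/eq_bigr => j _.
  congr (_ * _); rewrite !mxE; apply: eq_bigr => l _; congr (_ * _).
  by rewrite !mxE.
have : 0 <= (reduced_cost A c B *m std_var A b x) 0 0.
  rewrite mxE sumr_ge0// => j _.
  have [/codomP[i ->]|jB] := boolP (j \in codom B); first by rewrite rcB mul0r.
  by rewrite mulr_ge0 ?rc0 ?xC// inE.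
suff : (reduced_cost A c B *m std_var A b xbar) 0 0 = 0 by rewrite !rcE; lra.
rewrite mxE big1// => j _.
have [/codomP[i ->]|jB] := boolP (j \in codom B); first by rewrite rcB mul0r.
by rewrite nb0 ?mulr0// inE.
Qed.

End BasisCone.

(** * Cutting a polyhedron by a split set *)

Section SplitSets.
Variables (R : realType) (n : nat).
Implicit Types (x y c : 'cV[R]_n) (X Y : set 'cV[R]_n).

Lemma interior_slab (k : 'I_n) (lo hi : R) :
  [set x : 'cV[R]_n | lo <= x k 0 <= hi]° = [set x | lo < x k 0 < hi].
Proof.
apply/seteqP; split=> x.
  move=> /nbhs_ballP[e /= e0 ballS].
  have shift (t : R) : `|t| < e -> lo <= x k 0 + t <= hi.
    move=> te; have := ballS (x + const_mx t); rewrite /= !mxE; apply; split=> //.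
    by move=> i j; rewrite /ball/= !mxE opprD addNKr normrN.
  have := shift (e / 2); have := shift (- (e / 2)).
  rewrite normrN gtr0_norm; last by lra.
  by move=> /(_ ltac:(lra)) /andP[? _] /(_ ltac:(lra)) /andP[_ ?]; lra.
move=> /= xk; apply: (@filterS _ _ _ [set y : 'cV[R]_n | y k 0 \in `]lo, hi[]).
  by move=> y /=; rewrite in_itv /= => /andP[/ltW -> /ltW ->].
have /near_in_itvoo xI : x k 0 \in `]lo, hi[ by rewrite in_itv.
exact: (@coord_continuous R n 1 k 0 x _ xI).
Qed.

Lemma convex_halfspace c beta :
  convex_set ([set x | beta <= dotv c x] : set (convex_lmodType 'cV[R]_n)).
Proof.
move=> x y t; rewrite !inE /= => cx cy.
rewrite [X in dotv c X](_ : _ = t%:num *: x + (1 - t%:num) *: y)//.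
rewrite dotvD !dotvZ.
have : 0 <= t%:num * (dotv c x - beta) by rewrite mulr_ge0// subr_ge0.
have : 0 <= (1 - t%:num) * (dotv c y - beta) by rewrite mulr_ge0// subr_ge0.
by lra.
Qed.

(** The half-space of points at least as expensive as x is convex, so it contains
the convex hull as soon as it contains the set. *)
Lemma argmin_conv c X x : argmin (dotv c) X x -> argmin (dotv c) (Defs.conv X) x.
Proof.
move=> [Xx minx]; split; first exact: sub_gen_smallest.
by move=> y /(smallest_sub (@convex_halfspace c (dotv c x))); apply.
Qed.

Lemma argmin_setU (f : 'cV[R]_n -> R) X Y :
    (X !=set0 -> argmin f X !=set0) -> (Y !=set0 -> argmin f Y !=set0) ->
  X `|` Y !=set0 -> argmin f (X `|` Y) !=set0.
Proof.
move=> argX argY [z].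
have [/argX[x [Xx minx]]|X0] := pselect (X !=set0); last first.
  move=> [Xz|Yz]; first by case: X0; exists z.
  have [y [Yy miny]] := argY (ex_intro _ z Yz).
  by exists y; split=> [|w [Xw|/miny//]]; [right|case: X0; exists w].
have [/argY[y [Yy miny]] _|Y0 _] := pselect (Y !=set0); last first.
  by exists x; split=> [|w [/minx//|Yw]]; [left|case: Y0; exists w].
have [xy|yx] := leP (f x) (f y).
  exists x; split=> [|w [/minx//|/miny]]; [by left|exact: le_trans].
exists y; split=> [|w [/minx|/miny//]]; [by right|exact/le_trans/ltW].
Qed.

Lemma segment_hits (u v r : R) : (v <= r < u) || (u < r <= v) ->
  exists2 s : R, 0 <= s <= 1 & u + s * (v - u) = r.
Proof.
move=> H; have vu : v - u != 0.
  by rewrite subr_eq0; apply/eqP => vu; move: H; rewrite vu; lra.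
exists ((r - u) / (v - u)); last by rewrite divfK//; lra.
have [pos|neg] := ltP 0 (v - u).
  by rewrite divr_ge0 ?ler_pdivrMr//; move: H; lra.
have lt : v - u < 0 by rewrite lt_def eq_sym vu.
rewrite -mulrNN -invrN divr_ge0 ?ler_pdivrMr ?oppr_gt0//; move: H; lra.
Qed.

(** A point x that the hyperplane where l is r weakly separates from the cheapest
point u costs at least as much as some edge point on that hyperplane: along the
segment from u to x the cost stays below that of x. *)
Lemma cut_cost_ge (I : finType) (g : I -> 'cV[R]_n) h c l r u x low :
    spanning g [set: I]%SET ->
    (forall y, halfspaces g h y -> dotv c u <= dotv c y) ->
    halfspaces g h u -> halfspaces g h x ->
    (dotv l x <= r < dotv l u) || (dotv l u < r <= dotv l x) ->
    (forall F p, edge (halfspaces g h) F -> F p -> dotv l p = r -> low <= dotv c p) ->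
  low <= dotv c x.
Proof.
move=> sp umin Qu Qx between lowP.
have [s /andP[s0 s1] sr] := segment_hits between.
pose y := u + s *: (x - u).
have yE a : dotv a y = dotv a u + s * (dotv a x - dotv a u).
  by rewrite dotvD dotvZ dotvB.
have Qy : halfspaces g h y.
  move=> i; rewrite yE.
  have : 0 <= s * (dotv (g i) x - h i) by rewrite mulr_ge0// subr_ge0.
  have : 0 <= (1 - s) * (dotv (g i) u - h i) by rewrite mulr_ge0// subr_ge0.
  by lra.
have lu : dotv l u != r by apply/eqP => lu; move: between; rewrite lu; lra.
have [F [p [eF Fp lp cp]]] :=
  edge_crossing sp (fun y Qy _ => umin y Qy) Qu lu Qy (etrans (yE l) sr).
apply: le_trans (lowP F p eF Fp lp) _; apply: le_trans cp _; rewrite yE.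
have : 0 <= (1 - s) * (dotv c x - dotv c u) by rewrite mulr_ge0 ?subr_ge0// umin.
by lra.
Qed.

Lemma argmin_cut (I : finType) (g : I -> 'cV[R]_n) h c beta a r :
    spanning g [set: I]%SET ->
    (forall y, halfspaces g h y -> beta <= dotv c y) ->
  let X := halfspaces g h `&` [set x | r <= dotv a x] in
  X !=set0 -> argmin (dotv c) X !=set0.
Proof.
move=> sp bnd X.
pose g' s := if s is Some i then g i else a.
pose h' s := if s is Some i then h i else r.
have -> : X = halfspaces g' h'.
  apply/seteqP; split=> x; first by move=> [Qx ax] [i|]; [exact: Qx|exact: ax].
  by move=> Qx; split=> [i|]; [exact: (Qx (Some i))|exact: (Qx None)].
apply: (@argmin_exists _ _ _ _ _ _ beta).
  by move=> d z; apply: sp => i _; apply: (z (Some i)); rewrite inE.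
by move=> y Qy; apply: bnd => i; exact: (Qy (Some i)).
Qed.

End SplitSets.

(** * Bounds on the S-closure *)

Theorem theorem14 (R : realType) (m n : nat)
    (A : 'M[rat]_(m, n)) (b : 'cV[rat]_m) (c : 'cV[rat]_n)
    (I : {set 'I_n}) (k : 'I_n)
    (B : 'I_m -> 'I_(n + m)) (T : {set 'I_(n + m)})
    (xbar pup plow : 'cV[R]_n) (P C S : set 'cV[R]_n) (cost : 'cV[R]_n -> R)
    (hP : P = polyhedron (ratmx A) (ratmx b))
    (hcost : cost = dotv (ratmx c))
    (hdim : full_dimensional P) (hpointed : pointed_set P)
    (hxbar : optimal_bfs (ratmx A) (ratmx b) (ratmx c) B xbar)
    (hC : C = relaxation (ratmx A) (ratmx b) B T)
    (hk : k \in I) (hfrac : xbar k 0 \isn't a Num.int)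
    (hS : S = split_set xbar k)
    (hfinal : final_points P C S !=set0)
    (hpup : argmin cost (final_points P C S) pup)
    (hplow : argmin cost (intersection_points C S) plow) :
  (cost plow < cost pup ->
     exists zmin : R, is_minimum cost (S_closure P S) zmin /\
                      cost plow <= zmin <= cost pup) /\
  (~ (cost plow < cost pup) ->
     cost pup <= cost plow /\ is_minimum cost (S_closure P S) (cost pup)).
Proof.
set lo : R := (Num.floor (xbar k 0))%:~R.
set hi : R := (Num.ceil (xbar k 0))%:~R.
have lo_x : lo < xbar k 0.
  by rewrite lt_neqAle floor_le andbT; move: hfrac; rewrite intrEfloor.
have x_hi : xbar k 0 < hi.
  by rewrite lt_neqAle ceil_ge andbT eq_sym; move: hfrac; rewrite intrEceil.
have intS : S° = [set x | lo < x k 0 < hi] by rewrite hS interior_slab.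
have bdS (x : 'cV[R]_n) r : r = lo \/ r = hi -> x k 0 = r -> boundary S x.
  move=> rE xr; split; last by rewrite intS /= xr; case: rE => ->; lra.
  apply: topology_structure.subset_closure; rewrite hS /split_set /= -/lo -/hi xr.
  by case: rE => ->; lra.
have PC : P `<=` C by rewrite hP hC; exact: polyhedron_sub_relaxation.
have [hB hnb [Pxbar _] hrc] := hxbar.
rewrite -hP in Pxbar.
have Cmin y : C y -> cost xbar <= cost y.
  by rewrite hcost hC => -[/(basis_cone_cost_ge hxbar)].
have lower x : (P `\` S°) x -> cost plow <= cost x.
  move=> [/PC Cx xS]; rewrite hcost.
  have [r rE between] : exists2 r, r = lo \/ r = hi &
      (x k 0 <= r < xbar k 0) || (xbar k 0 < r <= x k 0).
    have [xlo|lox] := leP (x k 0) lo; first by exists lo; [left|lra].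
    exists hi; [by right|]; have [?|xhi] := leP hi (x k 0); first by lra.
    by case: xS; rewrite intS /=; lra.
  move: Cx (PC _ Pxbar) Cmin (hplow.2); rewrite hC relaxationE hcost.
  move=> Cx Cxbar Cmin low; apply: (cut_cost_ge (l := delta_mx k 0) (r := r) _ Cmin Cxbar Cx).
  - move=> d z; apply: (spanning_nonbasic hB) => j jB.
    have jU : j \in (nonbasic B :|: T)%SET by rewrite finset.in_setU jB.
    by apply: (z (exist _ j jU)); rewrite inE.
  - rewrite !dotv_delta; exact: between.
  - move=> F p eF Fp; rewrite dotv_delta => pr; apply: low.
    by exists F => //; split=> //; exact: bdS pr.
have upper : (P `\` S°) pup by have [[[F _ [_ []]]]] := hpup.
have [x xmin] : argmin cost (P `\` S°) !=set0.
  have : P `\` S° !=set0 by exists pup.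
  have -> : P `\` S° = (P `&` [set x | - lo <= dotv (- delta_mx k 0) x]) `|`
                      (P `&` [set x | hi <= dotv (delta_mx k 0) x]).
    rewrite intS; apply/seteqP; split=> x /=; rewrite dotvNl dotv_delta lerN2.
      move=> [Px xS]; have [?|?] := leP (x k 0) lo; [by left|right; split=> //].
      by rewrite leNgt; apply/negP => ?; apply: xS; lra.
    by move=> [] [Px ?]; split=> //; lra.
  have Pcut a r : P `&` [set x | r <= dotv a x] !=set0 ->
      argmin cost (P `&` [set x | r <= dotv a x]) !=set0.
    move: PC Cmin; rewrite hP hcost polyhedronE => PC Cmin.
    apply: (@argmin_cut _ _ _ _ _ _ (cost xbar)); rewrite ?hcost.
      by move=> d z; apply: (spanning_nonbasic hB) => j _; apply: z; rewrite inE.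
    by move=> y /PC; exact: Cmin.
  by apply: argmin_setU; exact: Pcut.
have minimum z : argmin cost (P `\` S°) z -> is_minimum cost (S_closure P S) (cost z).
  by rewrite hcost => ?; exists z => //; exact: argmin_conv.
split=> [_|/negP]; first exists (cost x).
  by split; [exact: minimum|rewrite lower ?xmin.2//; case: xmin].
rewrite -leNgt => uplow; split=> //; apply: minimum; split=> // y /lower.
exact: le_trans.
Qed.
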